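(* Let $(X,T)$ be a minimal Cantor system which is self-induced and expansive. Then $(X,T)$ is topologically conjugate to a substitution subshift $(X_\sigma,S)$ for some primitive substitution $\sigma$ on a finite alphabet.
   Context: A minimal Cantor system is a pair $(X,T)$ with $X$ a Cantor set and $T:X\to X$ a homeomorphism all of whose orbits are dense. For a clopen $U\subset X$, the return time is $r_U(x)=\inf\{n>0: T^nx\in U\}$ and the induced map is $T_U:U\to U$, $T_U(x)=T^{r_U(x)}(x)$. $(X,T)$ is self-induced if there is a nonempty clopen proper subset $U\subsetneq X$ such that $(U,T_U)$ is topologically conjugate to $(X,T)$. $T$ is expansive if there is $\delta>0$ such that for all $x\neq y$ there is $n\in\mathbb Z$ with $d(T^nx,T^ny)>\delta$. For a finite alphabet $\mathcal A$, a substitution is a map $\sigma:\mathcal A\to\mathcal A^+$ (nonempty words), extended to words by concatenation; it is primitive if there is $n$ such that every letter $b$ occurs in $\sigma^n(a)$ for all letters $a$, and there is a letter $a$ with $|\sigma^k(a)|\to\infty$. $X_\sigma\subset\mathcal A^{\mathbb Z}$ is the set of sequences every finite subword of which is a subword of some $\sigma^k(a)$, $a\in\mathcal A$, $k\ge 1$; $S$ is the shift $S(x)_i=x_{i+1}$. *)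

(* Defs.v *)
From HB Require Import structures.
From mathcomp Require Import all_boot all_order all_algebra.
From mathcomp Require Import all_classical all_reals.
From mathcomp Require Import topology cantor.

Set Implicit Arguments.
Unset Strict Implicit.
Unset Printing Implicit Defensive.

Import Order.TTheory GRing.Theory Num.Theory.
Local Open Scope classical_set_scope.
Local Open Scope ring_scope.

Definition is_homeomorphism (X Y : topologicalType) (f : X -> Y) : Prop :=
  continuous f /\ exists g : Y -> X, [/\ continuous g, cancel f g & cancel g f].

(** A Cantor set: a nonempty compact, perfect, Hausdorff, zero-dimensional
    (metrizable: X will be a metric space) space. *)
Definition cantor_set (X : topologicalType) : Prop :=
  [set: X] !=set0 /\ cantor_like X.

(** [zpow_rel T n x y] means  y = T^n x  for n : int, T a bijection
    (for negative n = -(k+1), it means T^(k+1) y = x). *)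
Definition zpow_rel (X : Type) (T : X -> X) (n : int) (x y : X) : Prop :=
  match n with
  | Posz k => iter k T x = y
  | Negz k => iter k.+1 T y = x
  end.

Definition orbit (X : Type) (T : X -> X) (x : X) : set X :=
  [set y | exists n : int, zpow_rel T n x y].

Definition minimal_cantor_system (X : topologicalType) (T : X -> X) : Prop :=
  [/\ cantor_set X, is_homeomorphism T & forall x, dense (orbit T x)].

(** Return time r_U(x) = inf{n > 0 | T^n x \in U} (set to 0 if no such n;
    this never happens for minimal systems and nonempty open U). *)
Definition return_time (X : Type) (T : X -> X) (U : set X) (x : X) : nat :=
  match pselect (exists n, (fun n => `[< (0 < n)%N /\ U (iter n T x) >]) n) with
  | left h => ex_minn h
  | right _ => 0%N
  end.

Definition induced_map (X : Type) (T : X -> X) (U : set X) (x : X) : X :=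
  iter (return_time T U x) T x.

Definition induced_conjugate (X : topologicalType) (T : X -> X) (U : set X)
  : Prop :=
  exists (phi psi : X -> X),
    [/\ {within U, continuous phi}, continuous psi,
        (forall y, U (psi y)),
        (forall x, U x -> psi (phi x) = x) /\ (forall y, phi (psi y) = y) &
        (forall x, U x -> phi (induced_map T U x) = T (phi x))].

Definition self_induced (X : topologicalType) (T : X -> X) : Prop :=
  exists U : set X, [/\ clopen U, U !=set0, U != setT & induced_conjugate T U].

Definition expansive (R : realType) (X : metricType R) (T : X -> X) : Prop :=
  exists delta : R, 0 < delta /\
    forall x y : X, x <> y ->
      exists (n : int) (x' y' : X),
        [/\ zpow_rel T n x x', zpow_rel T n y y' & delta < mdist x' y'].

Definition subst_word (A : Type) (sigma : A -> seq A) (w : seq A) : seq A :=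
  flatten (map sigma w).

Definition subst_iter (A : Type) (sigma : A -> seq A) (k : nat) (a : A) : seq A :=
  iter k (subst_word sigma) [:: a].

Definition is_substitution (A : Type) (sigma : A -> seq A) : Prop :=
  forall a, size (sigma a) != 0%N.

Definition primitive_substitution (A : finType) (sigma : A -> seq A) : Prop :=
  [/\ is_substitution sigma,
      (exists n : nat, forall a b : A, b \in subst_iter sigma n a) &
      (exists a : A, forall M : nat, exists K : nat, forall k : nat,
          (K <= k)%N -> (M <= size (subst_iter sigma k a))%N)].

Definition fullshift (A : finType) : Type := {ptws int -> discrete_topology A}.

Definition shift (A : finType) (x : fullshift A) : fullshift A :=
  fun i => x (i + 1).

Definition subword_at (A : finType) (x : fullshift A) (i : int) (n : nat) : seq A :=
  mkseq (fun j => x (i + j%:Z)) n.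

Definition subst_subshift (A : finType) (sigma : A -> seq A) : set (fullshift A) :=
  [set x | forall (i : int) (n : nat), exists (a : A) (k : nat),
      (1 <= k)%N /\ infix (subword_at x i n) (subst_iter sigma k a)].

Definition conjugate_to_subsystem (X Z : topologicalType) (T : X -> X)
  (Y : set Z) (S : Z -> Z) : Prop :=
  exists (h : X -> Z) (g : Z -> X),
    [/\ continuous h, {within Y, continuous g},
        range h = Y,
        (forall x, g (h x) = x) /\ (forall y, Y y -> h (g y) = y) &
        (forall x, h (T x) = S (h x))].

(* Main.v *)
Require Import Defs.
From HB Require Import structures.
From mathcomp Require Import all_boot all_order all_algebra.
From mathcomp Require Import all_classical all_reals.
From mathcomp Require Import topology cantor.
From mathcomp Require Import finmap zify.

Set Implicit Arguments.
Unset Strict Implicit.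
Unset Printing Implicit Defensive.

Local Open Scope classical_set_scope.

(** Self-induction gives a continuous [psi : X -> X] and a locally constant
    [r >= 1], not identically [1], with [psi (T x) = T^(r x) (psi x)].
    By minimality the Birkhoff sums of the cocycle of [psi^N] over [N] steps are
    at least [2 N] for large [N], so this cocycle is cohomologous to one
    bounded below by [2]: some [g x = T^(j x) (psi^N x)] satisfies
    [g (T x) = T^(f x) (g x)] with [f >= 2].  Expansivity gives a generating
    clopen partition; the names of [g x] on [[0, f x)] depend on a window of
    length [W] of the name of [x].  Since [f >= 2], passing to blocks of length
    [W] after a shift, the [W]-block at [x] determines the [W]-blocks at
    [T^i (g x)] for [i < f x]: this is a substitution on the [W]-blocks that
    occur, primitive by minimality because the images of a block under its
    iterates have unbounded length. *)

(** * Locally constant maps *)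

Definition loc_const (X : topologicalType) (D : Type) (f : X -> D) : Prop :=
  forall x, \forall y \near x, f y = f x.

Lemma loc_const_comp (X Y : topologicalType) (D : Type) (g : X -> Y)
    (f : Y -> D) :
  continuous g -> loc_const f -> loc_const (f \o g).
Proof. by move=> cg lf x; apply: cg (lf (g x)). Qed.

Lemma loc_const_map (X : topologicalType) (D E : Type) (F : D -> E)
    (f : X -> D) :
  loc_const f -> loc_const (fun x => F (f x)).
Proof. by move=> lf x; apply: filterS (lf x) => y ->. Qed.

Lemma loc_const_map2 (X : topologicalType) (D D' E : Type) (F : D -> D' -> E)
    (f : X -> D) (g : X -> D') :
  loc_const f -> loc_const g -> loc_const (fun x => F (f x) (g x)).
Proof. by move=> lf lg x; apply: filterS2 (lf x) (lg x) => y -> ->. Qed.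

(* The diagonal form lets a parameter of a locally constant function be itself
   locally constant. *)
Lemma loc_const_diag (X : topologicalType) (D E : Type) (n : X -> D)
    (f : D -> X -> E) :
  loc_const n -> (forall d, loc_const (f d)) -> loc_const (fun x => f (n x) x).
Proof. by move=> ln lf x; apply: filterS2 (ln x) (lf (n x) x) => y ->. Qed.

Lemma loc_const_sum (X : topologicalType) (f : nat -> X -> nat) n :
  (forall i, loc_const (f i)) -> loc_const (fun x => \sum_(i < n) f i x).
Proof.
move=> lf; elim: n => [|n IH] x.
  by apply: nearW => y; rewrite !big_ord0.
by apply: filterS2 (IH x) (lf n x) => y; rewrite !big_ord_recr /= => -> ->.
Qed.

Lemma loc_const_mkseq (X : topologicalType) (D : Type) (f : nat -> X -> D) n :
  (forall i, loc_const (f i)) -> loc_const (fun x => mkseq (f ^~ x) n).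
Proof.
move=> lf; elim: n => [|n IH] x; first by apply: nearW.
by apply: filterS2 (IH x) (lf n x) => y; rewrite !mkseqS /= => -> ->.
Qed.

Lemma loc_const_ffun (X : topologicalType) (I : finType) (D : Type)
    (f : I -> X -> D) :
  (forall i, loc_const (f i)) -> loc_const (fun x => [ffun i => f i x]).
Proof.
move=> lf x; have : \forall y \near x, forall i, f i y = f i x.
  by apply: filter_forall => i; apply: lf.
by apply: filterS => y fy; apply/ffunP => i; rewrite !ffunE.
Qed.

Lemma clopen_loc_const (X : topologicalType) (U : set X) :
  clopen U -> loc_const (fun x => `[<U x>]).
Proof.
move=> [oU cU] x; have [Ux|nUx] := pselect (U x).
  have : nbhs x U by apply: open_nbhs_nbhs; split.
  by apply: filterS => y Uy; apply/asboolP/asboolP.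
have : nbhs x (~` U) by apply: open_nbhs_nbhs; split=> //; apply: closed_openC.
by apply: filterS => y Uy; apply/asboolP/asboolP.
Qed.

Lemma loc_const_open (X : topologicalType) (D : Type) (f : X -> D) (A : set D) :
  loc_const f -> open (f @^-1` A).
Proof.
move=> lf; rewrite openE => x Ax; apply: filterS (lf x) => y /= fy.
by rewrite /preimage /= fy.
Qed.

(** * Compactness, integer iterates and bounded hitting times *)

(** This is the near-covering form of compactness along [\oo]: monotonicity makes membership at one
    index persist at all later ones. *)
Lemma compact_monotone_cover (X : topologicalType) (O : nat -> set X) :
  compact [set: X] -> (forall n, open (O n)) ->
  (forall m n x, (m <= n)%N -> O m x -> O n x) ->
  (forall x, exists n, O n x) -> exists n, forall x, O n x.
Proof.
move=> /compact_near_coveringP cX oO mO cO.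
have [x _|N _ NP] := cX nat \oo (fun n x => O n x) _.
  have [n Onx] := cO x; exists (O n, [set m | (n <= m)%N]) => /=.
    by split; [apply: open_nbhs_nbhs | exists n].
  by move=> [y m] /= [Oy nm]; apply: mO Oy.
by exists N => x; apply: (NP N) => /=.
Qed.

Lemma iter_continuous (X : topologicalType) (T : X -> X) n :
  continuous T -> continuous (iter n T).
Proof.
move=> cT; elim: n => [|n IH] x; first exact: cvg_id.
by apply: (@continuous_comp _ _ _ (iter n T) T) => //; [apply: IH | apply: cT].
Qed.

Lemma iter_cancel (X : Type) (T S : X -> X) n :
  cancel T S -> cancel (iter n T) (iter n S).
Proof. by move=> TK; elim: n => // n IH x; rewrite iterSr iterS TK IH. Qed.

Lemma continuous_loc_const_iter (X : topologicalType) (T g : X -> X)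
    (j : X -> nat) :
  continuous T -> continuous g -> loc_const j ->
  continuous (fun x => iter (j x) T (g x)).
Proof.
move=> cT cg lj x.
have := @continuous_comp _ _ _ g (iter (j x) T) x (cg x)
  (iter_continuous (n := j x) cT (x := g x)).
apply: cvg_trans; apply: near_eq_cvg.
by apply: filterS (lj x) => y /= ->.
Qed.

(** Functional counterpart of [zpow_rel], with [S] standing for the inverse of [T]. *)
Definition zit (X : Type) (T S : X -> X) (n : int) (x : X) : X :=
  match n with Posz k => iter k T x | Negz k => iter k.+1 S x end.

Lemma zitSr (X : Type) (T S : X -> X) n x :
  cancel T S -> zit T S (n + 1)%R x = zit T S n (T x).
Proof.
move=> TK; case: n => [k|k]; first by rewrite -PoszD addn1 /= -iterS iterSr.
have -> : (Negz k + 1)%R = (- k%:Z)%R by lia.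
case: k => [|k]; first by rewrite /= TK.
by rewrite -NegzE /= -[S (iter k S (T x))]iterS iterSr TK.
Qed.

Lemma zitS (X : Type) (T S : X -> X) n x :
  cancel S T -> zit T S (n + 1)%R x = T (zit T S n x).
Proof.
move=> SK; case: n => [k|k]; first by rewrite -PoszD addn1.
have -> : (Negz k + 1)%R = (- k%:Z)%R by lia.
by case: k => [|k]; rewrite -?NegzE /= SK.
Qed.

Lemma zitDn (X : Type) (T S : X -> X) n (k : nat) x :
  cancel S T -> zit T S (n + k%:Z)%R x = iter k T (zit T S n x).
Proof.
move=> SK; elim: k => [|k IH]; first by congr zit; lia.
by rewrite iterS -IH -zitS //; congr zit; lia.
Qed.

Lemma zitDr (X : Type) (T S : X -> X) n (k : nat) x :
  cancel T S -> zit T S (n + k%:Z)%R x = zit T S n (iter k T x).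
Proof.
move=> TK; elim: k x => [|k IH] x; first by congr zit; lia.
by rewrite iterSr -IH -zitSr //; congr zit; lia.
Qed.

Lemma zit_continuous (X : topologicalType) (T S : X -> X) n :
  continuous T -> continuous S -> continuous (zit T S n).
Proof. by move=> cT cS; case: n => k; apply: iter_continuous. Qed.

(** Density concerns two-sided orbits. Compactness bounds the hitting times by some [n] in absolute
    value, and delaying the start by [n] makes them all nonnegative. *)
Lemma forward_hitting (X : topologicalType) (T S : X -> X) (U : set X) :
  compact [set: X] -> continuous T -> continuous S -> cancel T S ->
  (forall x, dense (Defs.orbit T x)) -> open U -> U !=set0 ->
  exists N, forall x, exists2 i, (i < N)%N & U (iter i T x).
Proof.
move=> cX cT cS TK dT oU U0.
pose O n := [set x | exists2 i, (i <= n)%N & U (iter i T x) \/ U (iter i S x)].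
have oO n : open (O n).
  rewrite openE => x [i le_in Ui].
  have [Ux|Ux] := Ui.
    have : nbhs x (iter i T @^-1` U).
      by apply: iter_continuous => //; apply: open_nbhs_nbhs.
    by apply: filterS => y Uy; exists i => //; left.
  have : nbhs x (iter i S @^-1` U).
      by apply: iter_continuous => //; apply: open_nbhs_nbhs.
  by apply: filterS => y Uy; exists i => //; right.
have [||n On] := compact_monotone_cover cX oO.
- by move=> m n x le_mn [i le_im Ui]; exists i => //; apply: leq_trans le_mn.
- move=> x; have [y [Uy [[k|k] /= xy]]] := dT x U U0 oU.
    by exists k, k => //; left; rewrite xy.
  by exists k.+1, k.+1 => //; right; rewrite -xy -iterS iter_cancel.
(* Times in [[-n, n]] counted from [T^n x] are times in [[0, 2n]] counted from [x]. *)
exists n.*2.+1 => x; have [i le_in [Ui|Ui]] := On (iter n T x).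
  by exists (i + n)%N; [lia | rewrite iterD].
exists (n - i)%N; first by lia.
by move: Ui; rewrite -{1}(subnKC le_in) iterD iter_cancel.
Qed.

(** * Birkhoff sums and time changes *)

Definition birkhoff_sum (X : Type) (T : X -> X) (f : X -> nat) n x : nat :=
  \sum_(i < n) f (iter i T x).

Definition time_change (X : Type) (T g : X -> X) (f : X -> nat) : Prop :=
  forall x, g (T x) = iter (f x) T (g x).

Lemma birkhoff_sumS (X : Type) (T : X -> X) f n x :
  birkhoff_sum T f n.+1 x = (birkhoff_sum T f n x + f (iter n T x))%N.
Proof. by rewrite /birkhoff_sum big_ord_recr. Qed.

Lemma birkhoff_sumSr (X : Type) (T : X -> X) f n x :
  birkhoff_sum T f n.+1 x = (f x + birkhoff_sum T f n (T x))%N.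
Proof.
rewrite /birkhoff_sum big_ord_recl; congr addn.
by apply: eq_bigr => i _; rewrite /= -iterS iterSr.
Qed.

Lemma birkhoff_sumD (X : Type) (T : X -> X) f m n x :
  birkhoff_sum T f (m + n) x =
  (birkhoff_sum T f m x + birkhoff_sum T f n (iter m T x))%N.
Proof.
elim: n => [|n IH]; first by rewrite addn0 /birkhoff_sum big_ord0 addn0.
by rewrite addnS !birkhoff_sumS IH addnA [(m + n)%N]addnC iterD.
Qed.

Lemma birkhoff_sum_ge (X : Type) (T : X -> X) f c n x :
  (forall x, c <= f x)%N -> (n * c <= birkhoff_sum T f n x)%N.
Proof.
by move=> cf; elim: n => [//|n IH]; rewrite mulSnr birkhoff_sumS leq_add.
Qed.

(** All terms are at least 1, and one among the first [N] is at least 2. *)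
Lemma birkhoff_sum_gt (X : Type) (T : X -> X) f N m x :
  (forall x, 1 <= f x)%N ->
  (forall x, exists2 i, (i < N)%N & (2 <= f (iter i T x))%N) ->
  (N <= m)%N -> (m < birkhoff_sum T f m x)%N.
Proof.
move=> f1 f2 le_Nm; have [i lt_iN fi] := f2 x.
have -> : m = (i + (1 + (m - i.+1)))%N by lia.
rewrite !birkhoff_sumD birkhoff_sumSr {2}/birkhoff_sum big_ord0.
have := birkhoff_sum_ge T i x f1.
have := birkhoff_sum_ge T (m - i.+1) (iter 1 T (iter i T x)) f1.
lia.
Qed.

Lemma time_change_iter (X : Type) (T g : X -> X) f n x :
  time_change T g f -> g (iter n T x) = iter (birkhoff_sum T f n x) T (g x).
Proof.
move=> gf; elim: n => [|n IH]; first by rewrite /birkhoff_sum big_ord0.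
by rewrite iterS gf IH birkhoff_sumS addnC iterD.
Qed.

Lemma time_change_comp (X : Type) (T g h : X -> X) f r :
  time_change T g f -> time_change T h r ->
  time_change T (h \o g) (fun x => birkhoff_sum T r (f x) (g x)).
Proof. by move=> gf hr x /=; rewrite gf (time_change_iter _ _ hr). Qed.

Lemma birkhoff_sum_comp (X : Type) (T g : X -> X) f r n x :
  time_change T g f ->
  birkhoff_sum T (fun x => birkhoff_sum T r (f x) (g x)) n x =
  birkhoff_sum T r (birkhoff_sum T f n x) (g x).
Proof.
move=> gf; elim: n => [|n IH]; first by rewrite /birkhoff_sum !big_ord0.
by rewrite birkhoff_sumS IH birkhoff_sumS birkhoff_sumD (time_change_iter _ _ gf).
Qed.

Lemma loc_const_birkhoff_sum (X : topologicalType) (T : X -> X) f n :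
  continuous T -> loc_const f -> loc_const (birkhoff_sum T f n).
Proof.
move=> cT lf; apply: (@loc_const_sum _ (fun i x => f (iter i T x))) => i.
exact: loc_const_comp (iter_continuous cT) lf.
Qed.

(* Writing [G x] for the sum over [k < N] of the Birkhoff sums of length [k],
   [N f + G \o T - G] is the Birkhoff sum of length [N]: up to rounding, [f] is
   cohomologous to its average over [N] steps, with transfer function [G / N]. *)
Lemma sum_birkhoff_sum (X : Type) (T : X -> X) f N x :
  (N * f x + \sum_(k < N) birkhoff_sum T f k (T x) =
   \sum_(k < N) birkhoff_sum T f k x + birkhoff_sum T f N x)%N.
Proof.
elim: N => [|N IH]; first by rewrite !big_ord0 /birkhoff_sum big_ord0.
rewrite !big_ord_recr /= birkhoff_sumSr mulSn; move: IH.
set a := \sum_(_ < _) _; set b := \sum_(_ < _) _.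
set s := birkhoff_sum _ _ _ _; set t := birkhoff_sum _ _ _ _; lia.
Qed.

(** Replacing [g x] by [T^(j x) (g x)] adds the coboundary [j (T x) - j x] to the cocycle; with [j]
    the rounded transfer function, the average bound 2 becomes a pointwise bound. *)
Lemma accelerate (X : topologicalType) (T g : X -> X) f N :
  continuous T -> continuous g -> loc_const f -> time_change T g f ->
  (0 < N)%N -> (forall x, (N * 2 <= birkhoff_sum T f N x)%N) ->
  exists g' f', [/\ continuous g', loc_const f', time_change T g' f' &
                    forall x, (2 <= f' x)%N].
Proof.
move=> cT cg lf gf N0 f2.
pose G x := \sum_(k < N) birkhoff_sum T f k x; pose j x := (G x %/ N)%N.
have lj : loc_const j.
  apply: (@loc_const_map _ _ _ (fun n => n %/ N)%N).
  by apply: loc_const_sum => i; exact: loc_const_birkhoff_sum.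
have fj x : (2 + j x <= f x + j (T x))%N.
  have := sum_birkhoff_sum T f N x; rewrite -/(G x) -/(G (T x)) => GE.
  (* Both sides are quotients by [N] once 2 and [f x] enter the numerators as multiples of [N], so
     rounding down loses nothing. *)
  rewrite /j -!divnMDl // leq_div2r //.
  by have := f2 x; lia.
exists (fun x => iter (j x) T (g x)), (fun x => f x + j (T x) - j x)%N; split.
- exact: continuous_loc_const_iter.
- apply: (loc_const_map2 subn) => //; apply: (loc_const_map2 addn) => //.
  exact: loc_const_comp cT lj.
- move=> x; rewrite gf -!iterD; congr iter.
  by have := fj x; lia.
- by move=> x; have := fj x; lia.
Qed.

(** If the current sum over [N] steps is [m], composing once more with [g] gives a sum of [f] over
    [m] steps. As [m >= N], one of its terms is at least 2, so the new sum exceeds [m]. *)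
Lemma power_time_change (X : topologicalType) (T g : X -> X) f N k :
  continuous T -> continuous g -> loc_const f -> time_change T g f ->
  (forall x, 1 <= f x)%N ->
  (forall x, exists2 i, (i < N)%N & (2 <= f (iter i T x))%N) ->
  exists g' f', [/\ continuous g', loc_const f', time_change T g' f' &
                    forall x, (N + k <= birkhoff_sum T f' N x)%N].
Proof.
move=> cT cg lf gf f1 f2; elim: k => [|k [g' [f' [cg' lf' gf' ge]]]].
  exists g, f; split=> // x.
  by have := birkhoff_sum_ge T N x f1; rewrite muln1 addn0.
exists (g \o g'), (fun x => birkhoff_sum T f (f' x) (g' x)); split.
- by move=> x; apply: continuous_comp; [exact: cg' | exact: cg].
- apply: (@loc_const_diag _ _ _ f' (fun n x => birkhoff_sum T f n (g' x))) => //.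
  by move=> n; apply: (loc_const_comp cg'); exact: loc_const_birkhoff_sum.
- exact: time_change_comp.
- move=> x; rewrite (birkhoff_sum_comp _ _ _ gf') addnS.
  apply: leq_ltn_trans (ge x) _; apply: birkhoff_sum_gt f1 f2 _.
  by apply: leq_trans (ge x); rewrite leq_addr.
Qed.

(** * Names, generating codings and finite windows *)

Definition name (X D : Type) (T : X -> X) (c : X -> D) n x : seq D :=
  mkseq (fun i => c (iter i T x)) n.

Lemma nameD (X D : Type) (T : X -> X) (c : X -> D) m n x :
  name T c (m + n) x = name T c m x ++ name T c n (iter m T x).
Proof.
rewrite /name /mkseq iotaD map_cat add0n -[X in iota X n]addn0 iotaDl -map_comp.
by congr cat; apply: eq_map => i /=; rewrite addnC iterD.
Qed.

Lemma loc_const_name (X : topologicalType) (D : Type) (T : X -> X) (c : X -> D)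
    n :
  continuous T -> loc_const c -> loc_const (name T c n).
Proof.
move=> cT lc; apply: (@loc_const_mkseq _ _ (fun i x => c (iter i T x))) => i.
exact: loc_const_comp (iter_continuous cT) lc.
Qed.
Definition generating (X D : Type) (T S : X -> X) (c : X -> D) : Prop :=
  forall x y, (forall n, c (zit T S n x) = c (zit T S n y)) -> x = y.

Lemma loc_const_zit (X : topologicalType) (D : Type) (T S : X -> X) (c : X -> D)
    n :
  continuous T -> continuous S -> loc_const c ->
  loc_const (fun x => c (zit T S n x)).
Proof. by move=> cT cS; apply: loc_const_comp; exact: zit_continuous. Qed.

(** In the applications [F i] says that two codes differ at coordinate [i]: agreement on a finite
    window then forces [W]. *)
Lemma compact_int_cover (Y : topologicalType) (W : set Y) (F : int -> Y -> bool) :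
  compact [set: Y] -> open W -> (forall i, loc_const (F i)) ->
  (forall y, W y \/ exists i, F i y) ->
  exists n : nat, forall y, (forall i : int, (`|i| <= n)%N -> ~~ F i y) -> W y.
Proof.
move=> cY oW lF cov.
pose O n := [set y | W y \/ exists2 i : int, (`|i| <= n)%N & F i y].
have [|||n On] := @compact_monotone_cover _ O cY.
- move=> n; rewrite openE => y [Wy|[i le_in Fi]].
    have : nbhs y W by apply: open_nbhs_nbhs.
    by apply: filterS => z Wz; left.
  by apply: filterS (lF i y) => z Fz; right; exists i => //; rewrite Fz.
- move=> m n y le_mn [Wy|[i le_im Fi]]; [by left | right].
  by exists i => //; apply: leq_trans le_mn.
- move=> y; have [Wy|[i Fi]] := cov y; first by exists 0%N; left.
  by exists `|i|%N; right; exists i.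
exists n => y nF; have [//|[i le_in]] := On y.
by rewrite (negbTE (nF i le_in)).
Qed.

Lemma generating_nbhs (X : topologicalType) (D : eqType) (T S : X -> X)
    (c : X -> D) x (W : set X) :
  compact [set: X] -> continuous T -> continuous S -> loc_const c ->
  generating T S c -> nbhs x W ->
  exists n : nat, forall y,
    (forall i : int, (`|i| <= n)%N -> c (zit T S i y) = c (zit T S i x)) -> W y.
Proof.
move=> cX cT cS lc gc; rewrite nbhsE => -[V [oV Vx] VW].
have [||n nV] := @compact_int_cover X V
    (fun i y => c (zit T S i y) != c (zit T S i x)) cX oV.
- move=> i; apply: (@loc_const_map _ _ _ (fun a => a != c (zit T S i x))).
  exact: loc_const_zit.
- move=> y; have [[i ne]|eq] := pselect (exists i, c (zit T S i y) != c (zit T S i x)).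
    by right; exists i.
  left; suff -> : y = x by [].
  by apply: gc => i; apply/eqP/negPn/negP => ne; apply: eq; exists i.
exists n => y eq; apply/VW/nV => i le_in; apply/negPn/eqP; exact: eq.
Qed.

(** Compactness of [X * X] makes the window uniform in both points. Evaluating [f] at [T^n x] turns
    the window [[-n, n]] into the one-sided [[0, 2n]]. *)
Lemma generating_window (X : topologicalType) (D E : eqType) (T S : X -> X)
    (c : X -> D) (f : X -> E) :
  compact [set: X] -> continuous T -> continuous S -> cancel T S ->
  loc_const c -> generating T S c -> loc_const f ->
  exists n : nat, forall x y, name T c n.*2.+1 x = name T c n.*2.+1 y ->
    f (iter n T x) = f (iter n T y).
Proof.
move=> cX cT cS TK lc gc lf.
have cXX : compact [set: X * X] by rewrite -setXTT; exact: compact_setX.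
have l1 (G : Type) (F : X -> G) : loc_const F -> loc_const (fun p : X * X => F p.1).
  by move=> lF; apply: (loc_const_comp _ lF) => p; exact: cvg_fst.
have l2 (G : Type) (F : X -> G) : loc_const F -> loc_const (fun p : X * X => F p.2).
  by move=> lF; apply: (loc_const_comp _ lF) => p; exact: cvg_snd.
have [|||n nf] := @compact_int_cover _ [set p : X * X | f p.1 == f p.2]
    (fun i p => c (zit T S i p.1) != c (zit T S i p.2)) cXX.
- have := @loc_const_open _ _ (fun p : X * X => f p.1 == f p.2) is_true.
  by apply; apply: (loc_const_map2 eq_op); [exact: l1 | exact: l2].
- move=> i; apply: (@loc_const_map2 _ _ _ _ (fun a b => a != b)).
    exact: (l1 _ _ (loc_const_zit i cT cS lc)).
  exact: (l2 _ _ (loc_const_zit i cT cS lc)).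
- move=> p; have [[i ne]|eq] := pselect (exists i, c (zit T S i p.1) != c (zit T S i p.2)).
    by right; exists i.
  left; suff e : p.1 = p.2 by rewrite /= e.
  by apply: gc => i; apply/eqP/negPn/negP => ne; apply: eq; exists i.
exists n => x y eq.
apply/eqP/(nf (iter n T x, iter n T y)) => i le_in; apply/negPn/eqP => /=.
rewrite -!(zitDr _ _ _ TK); have -> : (i + n%:Z)%R = Posz `|(i + n%:Z)%R| by lia.
move: eq => /(congr1 (nth (c x) ^~ `|(i + n%:Z)%R|)).
by rewrite !nth_mkseq //; lia.
Qed.

Lemma nth_name (X D : Type) (T : X -> X) (c : X -> D) d n x i :
  (i < n)%N -> nth d (name T c n x) i = c (iter i T x).
Proof. by move=> lt_in; rewrite nth_mkseq. Qed.

Lemma size_name (X D : Type) (T : X -> X) (c : X -> D) n x :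
  size (name T c n x) = n.
Proof. exact: size_mkseq. Qed.

(** A [W]-block of [x] determines a stretch of the name of [g' x]. Since [f' >= 2], this stretch is
    long enough to contain the [W]-blocks starting at all times below [f' x]. *)
Lemma generating_higher_block (X : topologicalType) (D : eqType) (T S : X -> X)
    (c : X -> D) (g : X -> X) f :
  compact [set: X] -> continuous T -> continuous S -> cancel T S ->
  loc_const c -> generating T S c ->
  continuous g -> loc_const f -> time_change T g f -> (forall x, (2 <= f x)%N) ->
  exists W g' f', [/\ (0 < W)%N, time_change T g' f',
    forall x, (2 <= f' x)%N &
    forall x y, name T c W x = name T c W y ->
      name T (name T c W) (f' x) (g' x) = name T (name T c W) (f' y) (g' y)].
Proof.
move=> cX cT cS TK lc gc cg lf gf f2.
have lF : loc_const (fun x => name T c (f x) (g x)).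
  apply: (@loc_const_diag _ _ _ f (fun n x => name T c n (g x))) => // n.
  exact: (loc_const_comp cg (loc_const_name n cT lc)).
have [L LP] := generating_window cX cT cS TK lc gc lF.
(* Precomposing with [T^L] makes the window start at time 0. *)
pose g' x := g (iter L T x); pose f' x := f (iter L T x).
have gf' : time_change T g' f' by move=> x; rewrite /g' -iterSr iterS gf.
have f2' x : (2 <= f' x)%N by exact: f2.
(* With [M = 2L + 1] the window length and [W = 2M], the windows starting at times [0] to [M] all
   fit in a [W]-block. *)
pose W := (L.*2.+1.*2)%N; exists W, g', f'; split=> // x y eqW.
have eq1 i : (i <= L.*2.+1)%N ->
    name T c (f' (iter i T x)) (g' (iter i T x)) =
    name T c (f' (iter i T y)) (g' (iter i T y)).
  move=> le_i; apply: LP; apply: (@eq_from_nth _ (c x)); rewrite !size_name // => k lt_k.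
  rewrite !nth_name // -!iterD.
  move: eqW => /(congr1 (nth (c x) ^~ (k + i)%N)).
  by rewrite !nth_name //; rewrite /W; lia.
have eqf i : (i <= L.*2.+1)%N -> f' (iter i T x) = f' (iter i T y).
  by move=> /eq1/(congr1 size); rewrite !size_name.
have eqS n : (n <= L.*2.+2)%N -> birkhoff_sum T f' n x = birkhoff_sum T f' n y /\
    name T c (birkhoff_sum T f' n x) (g' x) = name T c (birkhoff_sum T f' n y) (g' y).
  elim: n => [|n IH] le_n; first by rewrite /birkhoff_sum !big_ord0.
  have [e1 e2] := IH (ltnW le_n); rewrite !birkhoff_sumS; split.
    by rewrite e1 eqf.
  by rewrite !nameD -!(time_change_iter _ _ gf') e2 eq1.
have [eS eN] := eqS _ (leqnn _).
have ef : f' x = f' y by exact: (eqf 0).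
apply: (@eq_from_nth _ [::]); rewrite !size_name // => i lt_i.
rewrite !nth_name -?ef //.
apply: (@eq_from_nth _ (c x)); rewrite !size_name // => k lt_k.
rewrite !nth_name // -!iterD.
(* The sum over [M + 1] steps is at least [f' x + 2M = f' x + W], which exceeds [k + i] for
   [i < f' x] and [k < W]. *)
have lt_ki : (k + i < birkhoff_sum T f' L.*2.+2 x)%N.
  rewrite birkhoff_sumSr.
  have := birkhoff_sum_ge T L.*2.+1 (T x) f2'; rewrite /W in lt_k; lia.
move: eN => /(congr1 (nth (c x) ^~ (k + i)%N)).
by rewrite !nth_name // -eS.
Qed.

(** * A generating coding from expansivity *)

(** Finitely many clopen sets inside balls of radius [delta / 2] cover [X], and a point is coded by
    its vector of memberships. Points with equal codes share one of these sets, so they are within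
    [delta]. *)
Lemma expansive_generating (R : realType) (X : metricType R) (T S : X -> X) :
  cantor_set X -> cancel T S -> cancel S T -> expansive T ->
  exists (A : finType) (c : X -> A), loc_const c /\ generating T S c.
Proof.
move=> [[x0 _] [_ cX hX zX]] TK SK [delta [delta0 sep]].
have e0 : (0 < delta / 2)%R by rewrite Num.Theory.divr_gt0.
have nbr x : exists D : set X, [/\ D x, clopen D & D `<=` ball x (delta / 2)%R].
  have [D [Dx cD] DB] := zero_dimensional_cvg hX zX cX (nbhsx_ballx x _ e0).
  by exists D.
have [D DP] := choice nbr.
have cov : [set: X] `<=` cover setT D by move=> x _; exists x => //; case: (DP x).
have oD x : setT x -> open (D x) by case: (DP x) => _ [].
have [F _ FD] : finite_subset_cover setT D setT.
  (* The open-cover form of compactness is used on [X] pointed at [x0]. *)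
  pose X' : ptopologicalType := HB.pack (X : Type) X (isPointed.Build X x0).
  by have := cX; rewrite (@compact_cover X'); apply.
pose c x := [ffun i : F => `[<D (val i) x>]].
exists {ffun F -> bool}, c; split.
  apply: loc_const_ffun => i; apply: clopen_loc_const.
  by case: (DP (val i)).
move=> x y eq; apply: contrapT => /sep[n [x' [y' [xx' yy']]]].
have zE z z' : zpow_rel T n z z' -> zit T S n z = z'.
  by case: n {xx' yy' eq} => k /= <- //; rewrite -iterS -[T _]iterS iter_cancel.
rewrite Order.TotalTheory.ltNge => /negP; apply.
have := eq n; rewrite (zE _ _ xx') (zE _ _ yy') => /ffunP cc.
have [i iF Dx'] := FD x' I.
have := cc [` iF]%fset; rewrite !ffunE /= => Dxy.
have Dy' : D i y' by apply: (iffLR (asbool_eq_equiv Dxy)).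
have [_ _ sD] := DP i.
have := ball_splitr (sD _ Dx') (sD _ Dy').
by rewrite ballEmdist /= => /Order.POrderTheory.ltW.
Qed.

(** * Coding into the full shift and the substitution *)

Lemma nbhs_fullshift (A : finType) (y : fullshift A) (n : nat) :
  nbhs y [set z : fullshift A | forall i : int, (`|i| <= n)%N -> z i = y i].
Proof.
have ev (i : int) : \forall z \near y, z i = y i.
  have : nbhs (y i : discrete_topology A) [set y i] by exact: discrete_set1.
  exact: (@proj_continuous int (fun=> discrete_topology A) i y).
have FF : Filter (nbhs y).
  exact: (@nbhs_filter {ptws int -> discrete_topology A} y).
(* The coordinates in [[-n, n]] are indexed by a finite type so that finitely many neighbourhoods
   can be intersected. *)
pose eq_at (j : 'I_n.*2.+1) : set (fullshift A) :=
  [set z | z (j%:Z - n%:Z)%R = y (j%:Z - n%:Z)%R].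
have := @filter_forall _ _ eq_at _ FF (fun j => ev _).
apply: filterS => z zy i le_in.
have lt_j : (`|(i + n%:Z)%R| < n.*2.+1)%N by lia.
have := zy (Ordinal lt_j); rewrite /eq_at /=.
by have -> : (Posz `|(i + n%:Z)%R| - n%:Z)%R = i by lia.
Qed.

Lemma loc_const_continuous_fullshift (X : topologicalType) (A : finType)
    (h : X -> fullshift A) :
  (forall i, loc_const (h ^~ i)) -> continuous h.
Proof.
move=> lh x; apply/cvg_sup => i.
move: x; apply/(@continuousP _ (initial_topology (@^~ i))) => B [C _ <-].
exact: (loc_const_open C (lh i)).
Qed.

(** Injectivity of the coding is [generating]. For surjectivity, compactness allows every point of
    [Y] to be tested on finite words, which are all names of points of [X]. *)
Lemma conjugate_to_coding (X : topologicalType) (T S : X -> X) (A : finType)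
    (c : X -> A) (Y : set (fullshift A)) :
  [set: X] !=set0 -> compact [set: X] -> continuous T -> continuous S ->
  cancel T S -> cancel S T -> loc_const c -> generating T S c ->
  (forall x, Y (fun i => c (zit T S i x))) ->
  (forall y i n, Y y -> exists x, subword_at y i n = name T c n x) ->
  conjugate_to_subsystem T Y (@Defs.shift A).
Proof.
move=> [x0 _] cX cT cS TK SK lc gc hY Yname.
pose h (x : X) : fullshift A := fun i => c (zit T S i x).
have h_inj x y : h x = h y -> x = y.
  by move=> hxy; apply: gc => n; exact: (congr1 (@^~ n) hxy).
have h_surj y : Y y -> exists x, h x = y.
  move=> Yy; apply: contrapT => nh.
  (* If [y] codes no point, a single window [[-n, n]] witnesses this for all [x] at once; the word
     of [y] on that window contradicts it. *)
  have [|||n nE] := @compact_int_cover X set0 (fun i x => h x i != y i) cX.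
  - exact: open0.
  - move=> i; apply: (@loc_const_map _ _ _ (fun a => a != y i)).
    exact: loc_const_zit.
  - move=> x; right; apply: contrapT => eq; apply: nh; exists x.
    by apply/funext => i; apply/eqP/negPn/negP => ne; apply: eq; exists i.
  have [x xE] := Yname y (- n%:Z)%R n.*2.+1 Yy.
  apply: (nE (iter n T x)) => i le_in; apply/negPn/eqP.
  rewrite /h -(zitDr _ _ _ TK).
  have -> : (i + n%:Z)%R = Posz `|(i + n%:Z)%R| by lia.
  move: xE => /(congr1 (nth (c x) ^~ `|(i + n%:Z)%R|)).
  rewrite nth_name; last by lia.
  rewrite nth_mkseq; last by lia.
  by move=> /= <-; congr y; lia.
(* The default [x0] is only reached outside [Y]. *)
pose g y := xget x0 [set x | h x = y].
have hg y : Y y -> h (g y) = y.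
  by move=> /h_surj[x hx]; rewrite /g; case: xgetP => [z _ //|/(_ x)]; case.
have gh x : g (h x) = x by apply: h_inj; apply: hg; exact: hY.
exists h, g; split=> //.
- by apply: loc_const_continuous_fullshift => i; exact: loc_const_zit.
- apply/subspace_continuousP => y Yy W /=.
  move=> /(generating_nbhs cX cT cS lc gc)[n nW].
  rewrite /nbhs /= /within /=; apply: filterS (nbhs_fullshift y n) => z zy Yz.
  apply: nW => i le_in.
  have := zy i le_in; rewrite -{1}(hg _ Yz) -{1}(hg _ Yy); exact.
- by apply/seteqP; split=> [_ [x _ <-]|y /h_surj[x hx]]; [exact: hY | exists x].
- move=> x; apply/funext => i; rewrite /h /Defs.shift.
  by rewrite (zitSr _ _ TK).
Qed.

(** The word [sigma a] is read along [g x] for any [x] coded by [a], so [sigma] carries names along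
    [x] to names along [g x]. Iterates on a letter are thus names of growing length, and minimality
    makes long names contain every word that occurs. *)
Lemma substitution_of_coding (X : topologicalType) (T S : X -> X) (A : finType)
    (c : X -> A) (g : X -> X) f :
  [set: X] !=set0 -> compact [set: X] -> continuous T -> continuous S ->
  cancel T S -> cancel S T -> (forall x, dense (Defs.orbit T x)) ->
  loc_const c -> generating T S c -> (forall a, exists x, c x = a) ->
  time_change T g f -> (forall x, (2 <= f x)%N) ->
  (forall x y, c x = c y -> name T c (f x) (g x) = name T c (f y) (g y)) ->
  exists sigma : A -> seq A, primitive_substitution sigma /\
    conjugate_to_subsystem T (subst_subshift sigma) (@Defs.shift A).
Proof.
move=> X0 cX cT cS TK SK dT lc gc c_surj gf f2 fc.
have [s sK] := choice c_surj.
pose sigma a := name T c (f (s a)) (g (s a)).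
have sigmaE x : sigma (c x) = name T c (f x) (g x) by apply: fc; rewrite sK.
have subst_name n x : subst_word sigma (name T c n x) =
    name T c (birkhoff_sum T f n x) (g x).
  elim: n => [|n IH]; first by rewrite /birkhoff_sum big_ord0.
  rewrite birkhoff_sumS nameD -(time_change_iter _ _ gf) -sigmaE -IH.
  by rewrite /subst_word /name mkseqS map_rcons flatten_rcons.
have subst_iter_name k a : exists x n,
    (k < n)%N /\ subst_iter sigma k a = name T c n x.
  elim: k => [|k [x [n [lt_kn E]]]].
    by exists (s a), 1%N; rewrite /name /mkseq /= sK.
  exists (g x), (birkhoff_sum T f n x); split.
    by have := birkhoff_sum_ge T n x f2; lia.
  by rewrite /subst_iter iterS -/(subst_iter sigma k a) E subst_name.
exists sigma; split; first split.
- by move=> a; rewrite size_name -lt0n (leq_trans _ (f2 _)).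
- have hit a : exists N, forall x, exists2 i, (i < N)%N & c (iter i T x) = a.
    apply: (forward_hitting cX cT cS TK dT (U := [set x | c x = a])).
      exact: (loc_const_open [set a] lc).
    exact: c_surj.
  have [N NP] := choice hit.
  (* The [k]-th iterate is a name of length above [k], so the largest hitting time over all letters
     serves as exponent. *)
  exists (\max_a N a) => a b.
  have [x [n [lt_n ->]]] := subst_iter_name (\max_a N a) a.
  have [i lt_i <-] := NP b x; apply/mapP; exists i => //.
  by rewrite mem_iota /= add0n (leq_trans lt_i) // (leq_trans _ (ltnW lt_n)) // (leq_bigmax b).
- have [x0 _] := X0; exists (c x0) => M; exists M => k le_Mk.
  have [x [n [lt_kn ->]]] := subst_iter_name k (c x0).
  by rewrite size_name (leq_trans le_Mk) // ltnW.
- apply: (conjugate_to_coding X0 cX cT cS TK SK lc gc).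
  + move=> x i n.
    have -> : subword_at (fun i => c (zit T S i x) : discrete_topology A) i n = name T c n (zit T S i x).
      by apply: eq_map => j; rewrite (zitDn _ _ _ SK).
    set u := name _ _ _ _.
    have [|N NP] := forward_hitting cX cT cS TK dT
        (loc_const_open [set u] (loc_const_name n cT lc)).
      by exists (zit T S i x).
    (* An occurrence of [u] starts before time [N] and has length [n], so it ends within the first
       [N + n] letters; the successor also gives [1 <= k]. *)
    exists (c x), (N + n).+1; split=> //.
    have [z [m [lt_m ->]]] := subst_iter_name (N + n).+1 (c x).
    have [j lt_j uE] := NP z.
    have -> : m = (j + (n + (m - (j + n))))%N by lia.
    rewrite !nameD -uE; apply/infixP.
    by exists (name T c j z), (name T c (m - (j + n)) (iter n T (iter j T z))).
  + move=> y i n /(_ i n)[a [k [_]]].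
    have [x [m [_ ->]]] := subst_iter_name k a => /infixP[p [q E]].
    exists (iter (size p) T x).
    have sz : m = (size p + (n + size q))%N.
      by rewrite -(size_name T c m x) E !size_cat size_mkseq.
    move: E; rewrite sz !nameD => /eqP; rewrite eqseq_cat ?size_name //.
    by move=> /andP[_]; rewrite eqseq_cat ?size_name ?size_mkseq // => /andP[/eqP <-].
Qed.

(** * Return times and self-induction *)

Lemma return_time_gt0 (X : Type) (T : X -> X) (U : set X) x n :
  (0 < n)%N -> U (iter n T x) ->
  (0 < return_time T U x)%N /\ U (induced_map T U x).
Proof.
move=> n0 Un; rewrite /induced_map /return_time; case: pselect => [h|]; last first.
  by case; exists n; apply/asboolP.
by case: ex_minnP => m /asboolP[].
Qed.

(** A visit at time [n > 0] bounds the minimum, so only the itinerary up to [n] matters. This yields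
    local constancy of the return time. *)
Lemma return_time_name (X : Type) (T : X -> X) (U : set X) x y n :
  (0 < n)%N -> U (iter n T x) ->
  name T (fun z => `[<U z>]) n.+1 x = name T (fun z => `[<U z>]) n.+1 y ->
  return_time T U x = return_time T U y.
Proof.
move=> n0 Un eq.
have UE i : (i <= n)%N -> U (iter i T x) <-> U (iter i T y).
  move=> le_in; apply: asbool_eq_equiv.
  by move: eq => /(congr1 (nth false ^~ i)); rewrite !nth_name.
have Uy : U (iter n T y) by apply/UE.
rewrite /return_time; case: pselect => [h|]; last by case; exists n; apply/asboolP.
case: pselect => [h'|]; last by case; exists n; apply/asboolP.
case: ex_minnP => m /asboolP[m0 Um] mP; case: ex_minnP => k /asboolP[k0 Uk] kP.
have le_mn : (m <= n)%N by apply: mP; apply/asboolP.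
have le_kn : (k <= n)%N by apply: kP; apply/asboolP.
apply/eqP; rewrite eqn_leq mP ?kP //; apply/asboolP; split=> //; exact/UE.
Qed.

(** The inverse conjugacy [psi] intertwines [T] with the induced map, hence is a time change with
    cocycle [r \o psi]. *)
Lemma self_induced_time_change (X : topologicalType) (T S : X -> X) :
  compact [set: X] -> continuous T -> continuous S -> cancel T S ->
  (forall x, dense (Defs.orbit T x)) -> self_induced T ->
  exists g f N, [/\ continuous g, loc_const f, time_change T g f,
    forall x, (1 <= f x)%N &
    forall x, exists2 i, (i < N)%N & (2 <= f (iter i T x))%N].
Proof.
move=> cX cT cS TK dT [U [cU U0 UT [phi [psi [_ cpsi Upsi [psiK phiK] phiT]]]]].
have [N NP] := forward_hitting cX cT cS TK dT cU.1 U0.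
have ret x : exists2 n, (0 < n)%N & U (iter n T x).
  by have [i _ Ui] := NP (T x); exists i.+1; rewrite // iterSr.
pose r := return_time T U.
have r0 x : (0 < r x)%N /\ U (induced_map T U x).
  by have [n n0 Un] := ret x; exact: return_time_gt0 n0 Un.
have lr : loc_const r.
  move=> x; have [n n0 Un] := ret x.
  apply: filterS (loc_const_name n.+1 cT (clopen_loc_const cU) x) => y eq.
  by apply/esym/(return_time_name n0 Un).
pose f x := r (psi x).
have lf : loc_const f := loc_const_comp cpsi lr.
have gf : time_change T psi f.
  move=> x; have := phiT _ (Upsi x); rewrite phiK => <-.
  by rewrite psiK //; case: (r0 (psi x)).
have f1 x : (1 <= f x)%N by case: (r0 (psi x)).
have V0 : [set x | (2 <= f x)%N] !=set0.
  apply: contrapT => nf.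
  have f_eq1 x : f x = 1%N.
    apply/eqP; rewrite eqn_leq f1 andbT leqNgt; apply/negP => f2.
    by apply: nf; exists x.
  (* Every point of [U] is some [psi y], so a cocycle identically 1 would make [U] forward
     invariant, although forward orbits must hit its nonempty complement. *)
  have UTstable x : U x -> U (T x).
    move=> Ux; have [_] := r0 x; rewrite /induced_map -/(r x).
    by have := f_eq1 (phi x); rewrite /f psiK // => /= ->.
  have nU0 : ~` U !=set0.
    by apply/set0P; apply: contra_neq UT => nU; rewrite -(setCK U) nU setC0.
  have [M MP] := forward_hitting cX cT cS TK dT (closed_openC cU.2) nU0.
  have [u Uu] := U0; have [i _] := MP u; apply.
  by elim: i => //= i; exact: UTstable.
have [M MP] := forward_hitting cX cT cS TK dT
  (loc_const_open [set n | (2 <= n)%N] lf) V0.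
by exists psi, f, M.
Qed.

(** * Conjugacy to a substitution subshift on blocks *)

Theorem mainTheorem1 (R : realType) (X : metricType R) (T : X -> X) :
  minimal_cantor_system T -> self_induced T -> expansive T ->
  exists (A : finType) (sigma : A -> seq A),
    primitive_substitution sigma /\
    conjugate_to_subsystem T (subst_subshift sigma) (@shift A).
Proof.
move=> [CX [cT [S [cS TK SK]]] dT] sT eT.
have [X0 [_ cX _ _]] := CX.
have [D [d [ld gd]]] := expansive_generating CX TK SK eT.
have [psi [r [N [cpsi lr psir r1 r2]]]] := self_induced_time_change cX cT cS TK dT sT.
(* Taking [k = N] gives sums of at least [2N] over [N] steps, as [accelerate] requires. *)
have [g [f [cg lf gf fN]]] := power_time_change N cT cpsi lr psir r1 r2.
have N0 : (0 < N)%N.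
  by have [x _] := X0; have [i lt_iN _] := r2 x; apply: leq_ltn_trans lt_iN.
have [|g' [f' [cg' lf' gf' f2']]] := accelerate cT cg lf gf N0.
  by move=> x; rewrite muln2 -addnn.
have [W [h [e [W0 he e2 eW]]]] :=
  generating_higher_block cX cT cS TK ld gd cg' lf' gf' f2'.
have szW x : size (name T d W x) == W by rewrite size_name.
pose w x : W.-tuple D := Tuple (szW x).
(* Only the blocks that occur are kept as letters, which makes the coding [c] surjective. *)
pose A := {a : W.-tuple D | `[<exists x, w x = a>]}.
have wA x : `[<exists y, w y = w x>] by apply/asboolP; exists x.
pose c x : A := exist _ (w x) (wA x).
have cE x y : c x = c y <-> name T d W x = name T d W y.
  split=> [/(congr1 val)/(congr1 val)//|eq]; exact/val_inj/val_inj.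
exists A; apply: (@substitution_of_coding _ T S A c h e) => //.
- move=> x; apply: filterS (loc_const_name W cT ld x) => y eq; exact/cE.
- move=> x y eq; apply: gd => n.
  have /cE/(congr1 (nth (d x) ^~ 0%N)) := eq n.
  by rewrite !nth_name.
- move=> [a aP]; have /asboolP[x xa] := aP; exists x; exact/val_inj.
- move=> x y /cE/eW.
  (* Forgetting the proofs of occurrence and of length is injective, so equality of names of blocks
     lifts to names over [A]. *)
  have nameE n z : name T (name T d W) n z = map (fun a : A => val (val a)) (name T c n z).
    by rewrite -map_comp.
  rewrite !nameE; apply: inj_map => a b ab; exact/val_inj/val_inj.
Qed.
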